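(* Let $$M_n=n\int_{[0,1]^d}\Big(C_n(\mathbf{u})-\prod_{j=1}^d u_j\Big)^2\prod_{j=1}^d u_j(1-u_j)\,d\mathbf{u}.$$ Then $$M_n=\sum_{i=1}^n\left[\frac1n\sum_{l=1}^n\prod_{j=1}^d\frac16\big(2(\hat U_{i,j}\vee\hat U_{l,j})+1\big)\big(\hat U_{i,j}\vee\hat U_{l,j}-1\big)^2-2\prod_{j=1}^d\left(\frac14\big(\hat U_{i,j}^4-1\big)+\frac13\big(1-\hat U_{i,j}^3\big)\right)\right]+\frac{n}{20^d}.$$
   Context: Let $d\ge2$ and let $(X_{i,1},\dots,X_{i,d})$, $i=1,\dots,n$, be a sample of $n$ observations in $\mathbb{R}^d$. With $\mathbb{I}$ the indicator function, set $\hat F_j(x)=\frac1n\sum_{i=1}^n\mathbb{I}(X_{i,j}\le x)$, $\hat U_{i,j}=\hat F_j(X_{i,j})$, and let the empirical copula be $$C_n(\mathbf{u})=\frac1n\sum_{i=1}^n\prod_{j=1}^d\mathbb{I}(\hat U_{i,j}\le u_j),\qquad\mathbf{u}\in[0,1]^d.$$ Write $a\vee b=\max(a,b)$; in particular $\hat U_{i,j}\vee\hat U_{l,j}-1$ means $\max(\hat U_{i,j},\hat U_{l,j})-1$. *)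

(* Defs.v *)
From HB Require Import structures.
From mathcomp Require Import all_boot all_order all_algebra.
From mathcomp Require Import all_classical all_reals all_analysis.
Set Implicit Arguments.
Unset Strict Implicit.
Unset Printing Implicit Defensive.
Import Order.TTheory GRing.Theory Num.Theory.
Local Open Scope classical_set_scope.
Local Open Scope ring_scope.

(* MathComp-Analysis equips [d.-tuple T] with the product sigma-algebra but
   has no product measure there.  The Lebesgue measure on R^d is built by
   induction on d, as the image of the product measure
   (Lebesgue on R) \x (Lebesgue on R^d) under (x, u) |-> x :: u; its value on
   boxes is given by [lebesgue_tuple_box]. *)
Definition cons_pair (R : realType) (d : nat)
    (p : measurableTypeR R * d.-tuple (measurableTypeR R)) :
  d.+1.-tuple (measurableTypeR R) := [the d.+1.-tuple _ of p.1 :: p.2].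

Lemma measurable_cons_pair (R : realType) (d : nat) :
  measurable_fun [set: measurableTypeR R * d.-tuple (measurableTypeR R)]
    (@cons_pair R d).
Proof. exact: measurable_cons measurable_fst measurable_snd. Qed.

HB.instance Definition _ (R : realType) (d : nat) :=
  isMeasurableFun.Build _ _ _ _ (@cons_pair R d) (@measurable_cons_pair R d).

Section lebesgue_cons.
Context (R : realType) (d : nat).
Variable mu :
  {sigma_finite_measure set (d.-tuple (measurableTypeR R)) -> \bar R}.
Local Open Scope ereal_scope.

Definition lebesgue_cons : set (d.+1.-tuple (measurableTypeR R)) -> \bar R :=
  pushforward (lebesgue_measure \x mu) (@cons_pair R d).

Let lebesgue_cons0 : lebesgue_cons set0 = 0.
Proof. exact: measure0. Qed.

Let lebesgue_cons_ge0 A : 0 <= lebesgue_cons A.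
Proof. exact: measure_ge0. Qed.

Let lebesgue_cons_sigma_additive : semi_sigma_additive lebesgue_cons.
Proof. exact: measure_semi_sigma_additive. Qed.

HB.instance Definition _ := isMeasure.Build _ _ _ lebesgue_cons
  lebesgue_cons0 lebesgue_cons_ge0 lebesgue_cons_sigma_additive.

Let measurable_thead :
  measurable_fun [set: d.+1.-tuple (measurableTypeR R)]
    (fun u => (thead u, [tuple of behead u])).
Proof.
apply: measurable_fun_pair; first exact: measurable_tnth.
exact: measurable_behead.
Qed.

Let lebesgue_cons_sigma_finite : sigma_finite setT lebesgue_cons.
Proof.
have /sigma_finiteP[F [TF ndF Foo]] := sigma_finiteT (@lebesgue_measure R).
have /sigma_finiteP[G [TG ndG Goo]] := sigma_finiteT mu.
pose g (u : d.+1.-tuple (measurableTypeR R)) := (thead u, [tuple of behead u]).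
have gK : g \o @cons_pair R d = id.
  by apply/funext => -[x u] /=; congr pair; exact/val_inj.
exists (fun i => g @^-1` (F i `*` G i)) => [|i].
  rewrite -preimage_bigcup (_ : \bigcup_i _ = setT) ?preimage_setT//.
  rewrite -subTset => -[x u] _.
  have [k _ Fx] : (\bigcup_i F i) x by rewrite -TF.
  have [m _ Gu] : (\bigcup_i G i) u by rewrite -TG.
  exists (maxn k m) => //; split => /=.
  - by move: x Fx; exact/subsetPset/ndF/leq_maxl.
  - by move: u Gu; exact/subsetPset/ndG/leq_maxr.
have [mF Fy] := Foo i; have [mG Gy] := Goo i; split.
  rewrite -[X in measurable X]setTI; apply: measurable_thead => //.
  exact: measurableX.
rewrite /lebesgue_cons /pushforward -comp_preimage gK preimage_id.
by rewrite product_measure1E// lte_mul_pinfty// ge0_fin_numE.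
Qed.

HB.instance Definition _ := Measure_isSigmaFinite.Build _ _ _ lebesgue_cons
  lebesgue_cons_sigma_finite.

End lebesgue_cons.

Fixpoint lebesgue_tuple (R : realType) (d : nat) :
    {sigma_finite_measure set (d.-tuple (measurableTypeR R)) -> \bar R} :=
  match d with
  | 0 => [the {sigma_finite_measure set _ -> \bar R} of
            dirac ([tuple] : 0.-tuple (measurableTypeR R))]
  | d'.+1 => [the {sigma_finite_measure set _ -> \bar R} of
            lebesgue_cons (lebesgue_tuple R d')]
  end.

Lemma measurable_box (R : realType) (d : nat)
    (A : 'I_d -> set (measurableTypeR R)) : (forall j, measurable (A j)) ->
  measurable [set u : d.-tuple (measurableTypeR R) | forall j, A j (tnth u j)].
Proof.
move=> mA.
rewrite (_ : mkset _ = \bigcap_(j in setT) ((fun u => tnth u j) @^-1` A j)).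
  apply: fin_bigcap_measurable => [|j _]; first exact: finite_finset.
  by rewrite -[X in measurable X]setTI; exact: measurable_tnth.
by apply/seteqP; split => u /= Au => [j _|j]; exact: Au.
Qed.

Lemma lebesgue_tuple_box (R : realType) (d : nat)
    (A : 'I_d -> set (measurableTypeR R)) : (forall j, measurable (A j)) ->
  lebesgue_tuple R d [set u | forall j, A j (tnth u j)] =
  (\prod_(j < d) lebesgue_measure (A j))%E.
Proof.
elim: d A => [|d IH] A mA /=.
  rewrite big_ord0 diracE mem_set//; by case.
rewrite big_ord_recl -IH; last by move=> j; exact: mA.
rewrite /lebesgue_cons /pushforward -product_measure1E//; last first.
  by apply: (measurable_box (A := fun j => A (lift ord0 j))) => j; exact: mA.
congr (_ _); apply/seteqP; split => -[x u] /=.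
  move=> Au; split; first exact: (Au ord0).
  by move=> j; have := Au (lift ord0 j); rewrite tnthS.
move=> [Ax Au] j; have [i ->|->//] := unliftP ord0 j.
by rewrite tnthS; exact: Au.
Qed.

(* Row i of [X] is the i-th observation, column j the sample of the j-th
   coordinate. *)
Definition ecdf (R : realType) (n d : nat) (X : 'M[R]_(n, d)) (j : 'I_d)
    (x : R) : R :=
  n%:R^-1 * \sum_(i < n) (X i j <= x)%R%:R.

Definition pseudo_obs (R : realType) (n d : nat) (X : 'M[R]_(n, d))
    (i : 'I_n) (j : 'I_d) : R :=
  ecdf X j (X i j).

Definition empirical_copula (R : realType) (n d : nat) (X : 'M[R]_(n, d))
    (u : d.-tuple (measurableTypeR R)) : R :=
  n%:R^-1 * \sum_(i < n) \prod_(j < d) (pseudo_obs X i j <= tnth u j)%R%:R.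

Definition unit_cube (R : realType) (d : nat) :
    set (d.-tuple (measurableTypeR R)) :=
  [set u | forall j : 'I_d, 0 <= (tnth u j : R) <= 1].

Definition Mstat (R : realType) (n d : nat) (X : 'M[R]_(n, d)) : R :=
  n%:R * \int[lebesgue_tuple R d]_(u in @unit_cube R d)
    ((empirical_copula X u - \prod_(j < d) (tnth u j : R)) ^+ 2 *
     \prod_(j < d) ((tnth u j : R) * (1 - (tnth u j : R)))).

(* Main.v *)
Require Import Defs.
From mathcomp Require Import all_boot all_order all_algebra.
From mathcomp Require Import all_classical all_reals all_analysis.
From mathcomp Require Import measurable_realfun.
From mathcomp Require Import ring.
Import Order.TTheory GRing.Theory Num.Theory.
Import numFieldNormedType.Exports.
Local Open Scope ring_scope.

(** Multiply the square of [C_n - \prod_j u_j] out.  A product of two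
    indicators [U_ij <= u_j] and [U_lj <= u_j] is the indicator of
    [max U_ij U_lj <= u_j], and [C_n] is an average of products of indicators,
    so the integrand becomes a finite linear combination of functions of the
    single shape [\prod_j (a_j <= u_j) u_j ^ k (1 - u_j)]: the square of [C_n]
    gives [k = 1] with maxima as thresholds, the cross term gives [k = 2] with
    the pseudo-observations, and the square of [\prod_j u_j] gives [k = 3] with
    threshold 0 ([sqr_discrepancy_expand]).

    The integral of such a function over the cube is the product over [j] of
    one-dimensional integrals: this is Tonelli's theorem applied [d] times,
    since Lebesgue measure on tuples is an iterated product
    ([integral_prod_tuple]).  The functions are nonnegative on the cube, so
    the same computation in the extended reals also gives their integrability,
    which the linearity of the integral needs.  Each one-dimensional factor is
    the integral of the polynomial [x ^ k (1 - x)] from [a_j] to 1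
    ([integral_beta_tail]), and the three kernels of the formula are its values
    for [k = 1, 2, 3]. *)

(** * One-dimensional integrals *)

Lemma integral_deriv_poly (R : realType) (p : {poly R}) (a b : R) : a <= b ->
  (\int[lebesgue_measure]_(x in `[a, b]) (p^`().[x])%:E = (p.[b] - p.[a])%:E)%E.
Proof.
rewrite le_eqVlt => /predU1P[<-|ab].
  by rewrite set_itv1 integral_set1 subrr.
rewrite (continuous_FTC2 (F := horner p) ab) ?EFinB//.
- by apply: continuous_subspaceT => x; exact: continuous_horner.
- split; first by move=> x _; exact: derivable_horner.
  + by apply: cvg_at_right_filter; exact: continuous_horner.
  + by apply: cvg_at_left_filter; exact: continuous_horner.
- by move=> x _; rewrite derive1E derive_val.
Qed.

(** The upper incomplete Beta integral of [x ^ k (1 - x)] from [a] to 1. *)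
Definition beta_tail {R : realType} (k : nat) (a : R) : R :=
  k.+1%:R^-1 * (1 - a ^+ k.+1) - k.+2%:R^-1 * (1 - a ^+ k.+2).

Lemma integral_beta_tail (R : realType) (k : nat) (a : R) : 0 <= a <= 1 ->
  (\int[lebesgue_measure]_(x in `[0%R, 1%R])
     ((a <= x)%R%:R * (x ^+ k * (1 - x)))%:E = (beta_tail k a)%:E)%E.
Proof.
move=> /andP[a0 a1].
pose p : {poly R} := k.+1%:R^-1 *: 'X^(k.+1) - k.+2%:R^-1 *: 'X^(k.+2).
have p' x : p^`().[x] = x ^+ k * (1 - x).
  have kV m (c : R) : m.+1%:R^-1 * (c *+ m.+1) = c.
    by rewrite mulrnAr -mulrnAl -[_ *+ _]mulr_natr mulVf ?pnatr_eq0// mul1r.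
  rewrite derivB !derivZ !derivXn hornerD hornerN !hornerZ !hornerMn.
  rewrite !hornerXn /=.
  by rewrite !kV exprSr mulrBr mulr1.
transitivity (\int[lebesgue_measure]_(x in `[a, 1%R]) (p^`().[x])%:E)%E.
  rewrite integral_mkcond [RHS]integral_mkcond; apply: eq_integral => x _.
  rewrite !patchE p' !mem_setE !in_itv/=.
  have [ax|xa] := leP a x; last by rewrite mul0r /= if_same.
  by rewrite (le_trans a0 ax) mul1r.
rewrite integral_deriv_poly// /p /beta_tail.
rewrite !(hornerD, hornerN, hornerZ, hornerXn).
congr EFin; rewrite !expr1n; ring.
Qed.

Lemma measurable_beta_factor (R : realType) (k : nat) (a : R) :
  measurable_fun setT (fun x : R => (a <= x)%R%:R * (x ^+ k * (1 - x))).
Proof.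
apply: measurable_funM.
  rewrite (_ : (fun _ => _) = \1_(`[a, +oo[%classic : set R)); last first.
    by apply/funext => x; rewrite indicE mem_setE in_itv/= andbT.
  exact: measurable_indic.
by apply: measurable_funM; [exact: measurable_funX|exact: measurable_funB].
Qed.

Lemma beta_tail1 (R : realType) (a : R) :
  beta_tail 1 a = 6^-1 * (2 * a + 1) * (a - 1) ^+ 2.
Proof. by rewrite /beta_tail; field. Qed.

Lemma beta_tail2 (R : realType) (a : R) :
  beta_tail 2 a = 4^-1 * (a ^+ 4 - 1) + 3^-1 * (1 - a ^+ 3).
Proof. by rewrite /beta_tail; field. Qed.

Lemma beta_tail3_0 (R : realType) : beta_tail 3 (0 : R) = 20^-1.
Proof. by rewrite /beta_tail; field. Qed.

(** * Integrals of products over the unit cube *)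

Lemma measurable_prod_tuple {R : realType} {d : nat} {f : 'I_d -> R -> R} :
  (forall j, measurable_fun setT (f j)) ->
  measurable_fun setT (EFin \o fun u : d.-tuple (measurableTypeR R) =>
    \prod_(j < d) f j (tnth u j)).
Proof.
move=> mf; apply/measurable_EFinP; apply: measurable_prod => j _.
exact: (measurableT_comp (mf j) (measurable_tnth j)).
Qed.

(** Nonnegativity makes Tonelli's theorem available at each coordinate without
    any integrability assumption, infinite factors included. *)
Lemma integral_prod_tuple (R : realType) (d : nat) (f : 'I_d -> R -> R) :
  (forall j, measurable_fun setT (f j)) -> (forall j x, 0 <= f j x) ->
  (\int[lebesgue_tuple R d]_u (\prod_(j < d) f j (tnth u j))%:E =
   \prod_(j < d) \int[lebesgue_measure]_x (f j x)%:E)%E.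
Proof.
elim: d f => [|d IH] f mf f0.
  rewrite big_ord0 /=; under eq_integral do rewrite big_ord0.
  by rewrite integral_cst//= diracT mul1e.
rewrite /= /lebesgue_cons.
rewrite (ge0_integral_pushforward (@measurable_cons_pair R d))//=; last 2 first.
- exact: measurable_prod_tuple.
- by move=> u _; rewrite lee_fin; exact: prodr_ge0.
rewrite preimage_setT fubini_tonelli1; last 2 first.
- exact: (measurableT_comp (measurable_prod_tuple mf)
    (@measurable_cons_pair R d)).
- by move=> u; rewrite lee_fin; exact: prodr_ge0.
rewrite /fubini_F/= big_ord_recl.
under eq_integral => x _.
  under eq_integral => u _.
    rewrite big_ord_recl EFinM.
    under eq_bigr => j _ do rewrite /= tnthS.
    rewrite (_ : tnth (cons_pair (x, u)) ord0 = x)//.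
    over.
  rewrite ge0_integralZl//; last 3 first.
  - exact: (measurable_prod_tuple (fun j => mf (lift ord0 j))).
  - by move=> u _; rewrite lee_fin; exact: prodr_ge0.
  - by rewrite lee_fin.
  rewrite (IH (fun j => f (lift ord0 j)))//.
  over.
(* The integral over the last d coordinates is now a constant factor. *)
rewrite ge0_integralZr//; last 3 first.
- by apply/measurable_EFinP; exact: mf.
- by move=> x _; rewrite lee_fin.
- by apply: prode_ge0 => j _; apply: integral_ge0 => x _; rewrite lee_fin.
Qed.

Lemma measurable_unit_cube (R : realType) (d : nat) :
  measurable (@unit_cube R d).
Proof.
apply: (measurable_box (A := fun=> [set x : R | 0 <= x <= 1]%classic)) => j.
by rewrite -set_itvcc; exact: measurable_itv.
Qed.

(** The indicator of the cube is itself a product over coordinates, so it can be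
    absorbed into the factors. *)
Lemma integral_unit_cube_prod {R : realType} {d : nat} (f : 'I_d -> R -> R) :
  (forall j, measurable_fun setT (f j)) ->
  (forall j x, 0 <= x <= 1 -> 0 <= f j x) ->
  (\int[lebesgue_tuple R d]_(u in @unit_cube R d)
     (\prod_(j < d) f j (tnth u j))%:E =
   \prod_(j < d) \int[lebesgue_measure]_(x in `[0%R, 1%R]) (f j x)%:E)%E.
Proof.
move=> mf f0; pose g j : R -> R := f j \_ `[0, 1]%classic.
have gE j x : g j x = if 0 <= x <= 1 then f j x else 0.
  by rewrite /g patchE mem_setE in_itv.
rewrite integral_mkcond.
transitivity (\int[lebesgue_tuple R d]_u
    (\prod_(j < d) g j (tnth u j))%:E)%E.
  apply: eq_integral => u _; rewrite patchE; case: ifPn => [/set_mem Cu|].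
    by congr EFin; apply: eq_bigr => j _; rewrite gE Cu.
  move=> /negP nCu.
  have [j /negPf uj] : exists j, ~~ (0 <= (tnth u j : R) <= 1).
    by apply/existsP; rewrite -negb_forall; apply/negP => /forallP Cu;
      apply: nCu; rewrite inE.
  by rewrite (bigD1 j)//= gE uj mul0r.
rewrite integral_prod_tuple.
- apply: eq_bigr => j _; rewrite [RHS]integral_mkcond.
  by apply: eq_integral => x _; rewrite restrict_EFin.
- move=> j; apply: (proj1 (measurable_restrictT (f j) (measurable_itv _))).
  by apply: measurable_funTS; exact: mf.
- by move=> j x; rewrite gE; case: ifPn => // /f0.
Qed.

Definition beta_tail_prod {R : realType} {d : nat} (k : nat) (a : 'I_d -> R)
    (u : d.-tuple (measurableTypeR R)) : R :=
  \prod_(j < d)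
    ((a j <= tnth u j)%R%:R * ((tnth u j : R) ^+ k * (1 - tnth u j))).

Lemma integral_beta_tail_prod (R : realType) (d k : nat) (a : 'I_d -> R) :
  (forall j, 0 <= a j <= 1) ->
  (\int[lebesgue_tuple R d]_(u in @unit_cube R d) (beta_tail_prod k a u)%:E =
   (\prod_(j < d) beta_tail k (a j))%:E)%E.
Proof.
move=> a01; rewrite /beta_tail_prod.
rewrite (integral_unit_cube_prod
  (fun j x => (a j <= x)%R%:R * (x ^+ k * (1 - x)))).
- by under eq_bigr do rewrite integral_beta_tail//; rewrite prodEFin.
- by move=> j; exact: measurable_beta_factor.
- by move=> j x /andP[x0 x1]; rewrite !mulr_ge0// ?exprn_ge0// subr_ge0.
Qed.

(** The function is its own absolute value on the cube, so its integral, which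
    is finite, is also the integral of its norm. *)
Lemma integrable_beta_tail_prod {R : realType} {d : nat} (k : nat)
    {a : 'I_d -> R} :
  (forall j, 0 <= a j <= 1) ->
  (lebesgue_tuple R d).-integrable (@unit_cube R d)
    (EFin \o beta_tail_prod k a).
Proof.
move=> a01; apply/integrableP; split.
  apply: measurable_funTS; apply: (measurable_prod_tuple
    (f := fun j x => (a j <= x)%R%:R * (x ^+ k * (1 - x)))) => j.
  exact: measurable_beta_factor.
rewrite (eq_integral (EFin \o beta_tail_prod k a)) => [|u /set_mem Cu].
  by rewrite integral_beta_tail_prod// ltry.
rewrite /= ger0_norm//; apply: prodr_ge0 => j _.
have /andP[u0 u1] := Cu j.
by rewrite !mulr_ge0// ?exprn_ge0// subr_ge0.
Qed.

Lemma Rintegral_beta_tail_prod (R : realType) (d k : nat) (a : 'I_d -> R) :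
  (forall j, 0 <= a j <= 1) ->
  \int[lebesgue_tuple R d]_(u in @unit_cube R d) beta_tail_prod k a u =
  \prod_(j < d) beta_tail k (a j).
Proof. by move=> a01; rewrite /Rintegral integral_beta_tail_prod. Qed.

(** * Linearity for finite sums of real-valued functions *)

Lemma integrable_sum_EFin {d} {T : measurableType d} {R : realType}
    {mu : {measure set T -> \bar R}} {D : set T} {I : Type} (s : seq I)
    {f : I -> T -> R} :
  measurable D -> (forall i, mu.-integrable D (EFin \o f i)) ->
  mu.-integrable D (EFin \o fun x => \sum_(i <- s) f i x).
Proof.
move=> mD intf.
rewrite (_ : _ \o _ = fun x => (\sum_(i <- s) (f i x)%:E)%E).
  by apply: integrable_sum => // i _; exact: intf.
by apply/funext => x; rewrite /= sumEFin.
Qed.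

Lemma Rintegral_sum d (T : measurableType d) (R : realType)
    (mu : {measure set T -> \bar R}) (D : set T) (I : Type) (s : seq I)
    (f : I -> T -> R) :
  measurable D -> (forall i, mu.-integrable D (EFin \o f i)) ->
  \int[mu]_(x in D) (\sum_(i <- s) f i x) =
  \sum_(i <- s) \int[mu]_(x in D) f i x.
Proof.
move=> mD intf; elim: s => [|i s IH].
  under eq_Rintegral do rewrite big_nil.
  by rewrite big_nil /Rintegral integral0.
under eq_Rintegral do rewrite big_cons.
by rewrite big_cons RintegralD ?IH//; exact: integrable_sum_EFin.
Qed.

(** * The statistic *)

Lemma pseudo_obs_itv (R : realType) (n d : nat) (X : 'M[R]_(n, d)) i j :
  0 <= pseudo_obs X i j <= 1.
Proof.
have n0 : (0 < n)%N by apply: leq_ltn_trans (ltn_ord i).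
rewrite /pseudo_obs /ecdf mulr_ge0 ?invr_ge0 ?sumr_ge0//=.
rewrite ler_pdivrMl ?ltr0n// mulr1 -[in leRHS](card_ord n) -sumr_const.
by apply: ler_sum => l _; rewrite lern1 leq_b1.
Qed.

(** The square of [\prod_j u_j] carries no indicator of its own; on the cube the
    threshold 0 supplies one equal to 1, which gives the three summands a common
    shape. *)
Lemma sqr_discrepancy_expand (R : realType) (n d : nat) (X : 'M[R]_(n, d))
    (u : d.-tuple (measurableTypeR R)) : unit_cube u ->
  (empirical_copula X u - \prod_(j < d) (tnth u j : R)) ^+ 2 *
     \prod_(j < d) ((tnth u j : R) * (1 - (tnth u j : R))) =
  n%:R^-1 ^+ 2 * (\sum_(i < n) \sum_(l < n) beta_tail_prod 1
     (fun j => Num.max (pseudo_obs X i j) (pseudo_obs X l j)) u)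
  - 2 * n%:R^-1 * (\sum_(i < n) beta_tail_prod 2 (pseudo_obs X i) u)
  + beta_tail_prod 3 (fun=> 0) u.
Proof.
move=> Cu; rewrite /empirical_copula.
set P := \prod_(j < d) (tnth u j : R); set W := \prod_(j < d) (_ * _).
set S := \sum_(i < n) \prod_(j < d) (pseudo_obs X i j <= tnth u j)%R%:R.
have -> : \sum_(i < n) \sum_(l < n) beta_tail_prod 1
    (fun j => Num.max (pseudo_obs X i j) (pseudo_obs X l j)) u = S ^+ 2 * W.
  rewrite expr2 mulr_suml mulr_suml; apply: eq_bigr => i _.
  rewrite mulr_sumr mulr_suml; apply: eq_bigr => l _.
  rewrite -!big_split; apply: eq_bigr => j _ /=.
  by rewrite ge_max -mulnb natrM expr1.
have -> : \sum_(i < n) beta_tail_prod 2 (pseudo_obs X i) u = S * P * W.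
  rewrite -mulrA mulr_suml; apply: eq_bigr => i _.
  rewrite -!big_split; apply: eq_bigr => j _ /=.
  by rewrite expr2 !mulrA.
have -> : beta_tail_prod 3 (fun=> 0) u = P ^+ 2 * W.
  rewrite expr2 -!big_split; apply: eq_bigr => j _ /=.
  by have /andP[-> _] := Cu j; rewrite mul1r !exprS expr0 mulr1 !mulrA.
ring.
Qed.

Theorem proposition4 (R : realType) (n d : nat) (X : 'M[R]_(n, d))
    (hn : (0 < n)%N) (hd : (2 <= d)%N) :
  Mstat X =
  \sum_(i < n)
    (n%:R^-1 * \sum_(l < n) \prod_(j < d)
        (6^-1
         * (2 * Num.max (pseudo_obs X i j) (pseudo_obs X l j) + 1)
         * (Num.max (pseudo_obs X i j) (pseudo_obs X l j) - 1) ^+ 2)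
     - 2 * \prod_(j < d)
        (4^-1 * (pseudo_obs X i j ^+ 4 - 1)
         + 3^-1 * (1 - pseudo_obs X i j ^+ 3)))
  + n%:R / 20 ^+ d.
Proof.
have U01 i j : 0 <= pseudo_obs X i j <= 1 by exact: pseudo_obs_itv.
have max01 i l j :
    0 <= Num.max (pseudo_obs X i j) (pseudo_obs X l j) <= 1.
  by rewrite maxEle; case: ifP.
have zero01 (j : 'I_d) : 0 <= (0 : R) <= 1 by rewrite lexx ler01.
have mC := @measurable_unit_cube R d.
have int1 i l := integrable_beta_tail_prod 1 (max01 i l).
have int1s i := integrable_sum_EFin (index_enum 'I_n) mC (int1 i).
have int1ss := integrable_sum_EFin (index_enum 'I_n) mC int1s.
have int2 i := integrable_beta_tail_prod 2 (U01 i).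
have int2s := integrable_sum_EFin (index_enum 'I_n) mC int2.
have int3 := integrable_beta_tail_prod 3 zero01.
have int1Z := integrableZl mC (n%:R^-1 ^+ 2) int1ss.
have int2Z := integrableZl mC (2 * n%:R^-1) int2s.
rewrite /Mstat.
under eq_Rintegral => u /set_mem Cu do rewrite sqr_discrepancy_expand//.
rewrite RintegralD//; last exact: (integrableB mC int1Z int2Z).
rewrite RintegralB// !RintegralZl// !Rintegral_sum//.
under eq_bigr => i _ do rewrite Rintegral_sum//.
under eq_bigr => i _.
  under eq_bigr => l _ do rewrite Rintegral_beta_tail_prod//.
  over.
under [X in _ * (_ - _ * X + _)]eq_bigr => i _ do
  rewrite Rintegral_beta_tail_prod//.
rewrite Rintegral_beta_tail_prod//.
under eq_bigr => i _.
  under eq_bigr => l _.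
    under eq_bigr do rewrite beta_tail1.
    over.
  over.
under [X in _ - _ * X]eq_bigr => i _.
  under eq_bigr do rewrite beta_tail2.
  over.
under [X in _ + X]eq_bigr do rewrite beta_tail3_0.
rewrite prodr_const card_ord -exprVn sumrB -!mulr_sumr.
have n0 : n%:R != 0 :> R by rewrite pnatr_eq0 -lt0n.
by rewrite mulrDr mulrBr; congr (_ - _ + _); field.
Qed.
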